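(* Let $G$ be a finite group and let $S$ be a non-empty inverse-closed subset of $G\setminus\{1\}$ such that $H:=\langle S\rangle\neq G$. Let $\mathbb{F}$ be a finite field. Then for each linear code $B\le \mathbb{F}^S$: (a) the Cayley code $\mathbf{C}(G,S,B)$ decomposes as a direct sum of $|G:H|$ linear codes, each isomorphic to the Cayley code $\mathbf{C}(H,S,B)$; (b) moreover, $\mathbf{C}(H,S,B)$ and $\mathbf{C}(G,S,B)$ have the same rate and the same minimum distance, and $\mathbf{C}(H,S,B)$ is symmetric if and only if $\mathbf{C}(G,S,B)$ is symmetric.
   Context: For a finite set $X$, $\mathbb{F}^X$ is the $\mathbb{F}$-vector space of functions $f:X\to\mathbb{F}$. A linear code is a subspace $C\le\mathbb{F}^X$; its length is $|X|$, its rate is $\dim(C)/|X|$, and its minimum distance is the minimum Hamming weight (number of non-zero entries) of a non-zero element of $C$ (so statements about minimum distance concern non-zero codes). $\mathrm{Aut}(C)$ is the group of all $\rho\in\mathrm{Sym}(X)$ whose induced action on $\mathbb{F}^X$ leaves $C$ invariant; $C$ is symmetric if $\mathrm{Aut}(C)$ is transitive on $X$. Two linear codes $C\le\mathbb{F}^X$, $D\le\mathbb{F}^Y$ are isomorphic if some bijection $X\to Y$ induces a linear isomorphism $\mathbb{F}^Y\to\mathbb{F}^X$ mapping $D$ onto $C$. If $X=\bigcup_k X_k$ is a disjoint union then $\mathbb{F}^X=\bigoplus_k\mathbb{F}^{X_k}$, and direct sums of codes $C_k\le \mathbb{F}^{X_k}$ are taken in this sense. For a finite group $G$ and a non-empty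 inverse-closed subset $S\subseteq G\setminus\{1\}$, the Cayley graph $\mathrm{Cay}(G,S)$ has vertex set $G$ and edge set $E=\{\{g,sg\}\mid g\in G,\ s\in S\}$. For a linear code $B\le\mathbb{F}^S$, the Cayley code is $$\mathbf{C}(G,S,B)=\{f\in\mathbb{F}^E\mid \text{for all } g\in G, \text{ the function } S\to\mathbb{F},\ s\mapsto f(\{g,sg\}), \text{ lies in } B\}.$$ $\mathbf{C}(H,S,B)$ is defined in the same way from the group $H$ and the graph $\mathrm{Cay}(H,S)$. *)

(* Defs.v *)
From HB Require Import structures.
From mathcomp Require Import all_boot all_order all_algebra all_fingroup.

Set Implicit Arguments.
Unset Strict Implicit.
Unset Printing Implicit Defensive.

Import GroupScope GRing.Theory.
Local Open Scope ring_scope.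

Notation elt A := {x | x \in A}.

Notation code F X := {vspace {ffun X -> F^o}}.

Section Codes.
Variable F : fieldType.

Section Pullback.
Variables (X Y : finType) (h : X -> Y).

Definition pullback (f : {ffun Y -> F^o}) : {ffun X -> F^o} :=
  [ffun x => f (h x)].

Fact pullback_is_linear : linear pullback.
Proof. by move=> a f g; apply/ffunP=> x; rewrite !ffunE. Qed.

HB.instance Definition _ :=
  GRing.isLinear.Build F {ffun Y -> F^o} {ffun X -> F^o} *:%R pullback
    pullback_is_linear.

End Pullback.

Section Extension.
Variables (X : finType) (A : {set X}).

(* The embedding of F^A as the direct summand of F^X of the functions
   supported in A. *)
Definition ext0 (f : {ffun elt A -> F^o}) : {ffun X -> F^o} :=
  [ffun x => oapp f 0 (insub x)].

Fact ext0_is_linear : linear ext0.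
Proof.
move=> a f g; apply/ffunP=> x; rewrite !ffunE.
by case: insub => [y|] /=; rewrite ?ffunE // scaler0 addr0.
Qed.

HB.instance Definition _ :=
  GRing.isLinear.Build F {ffun elt A -> F^o} {ffun X -> F^o} *:%R ext0
    ext0_is_linear.

End Extension.

Definition code_iso (X Y : finType) (C : code F X) (D : code F Y) : Prop :=
  exists2 h : X -> Y, bijective h & (linfun (pullback h) @: D)%VS = C.

Definition code_direct_sum (X I : finType) (A : I -> {set X})
    (D : forall i, code F (elt (A i))) (C : code F X) : Prop :=
  [/\ forall i j, i != j -> [disjoint A i & A j],
      \bigcup_i A i = [set: X],
      directv (\sum_i (linfun (@ext0 X (A i)) @: D i))
    & C = (\sum_i (linfun (@ext0 X (A i)) @: D i))%VS].

Section CodeInvariants.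
Variable X : finType.
Implicit Types (C : code F X) (f : {ffun X -> F^o}).

Definition rate C : rat := (\dim C)%:R / #|X|%:R.

Definition hamming_weight f : nat := #|[set x | f x != 0]|.

(* A relation rather than a function: the zero code has no minimum distance. *)
Definition is_min_distance C (d : nat) : Prop :=
  (exists f, [/\ f \in C, f != 0 & hamming_weight f = d]) /\
  (forall f, f \in C -> f != 0 -> (d <= hamming_weight f)%N).

Definition code_aut C : {set {perm X}} :=
  [set rho : {perm X} | (linfun (pullback rho) @: C)%VS == C].

Fact code_aut_group_set C : group_set (code_aut C).
Proof.
apply/group_setP; split=> [|r s].
  rewrite inE -[X in _ == X](lim1g C); apply/eqP; congr (_ @: _)%VS.
  by apply/lfunP=> f; rewrite id_lfunE lfunE; apply/ffunP=> x; rewrite ffunE perm1.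
rewrite !inE => /eqP Cr /eqP Cs; rewrite -[X in _ == X]Cr -[in X in _ == X]Cs.
rewrite -limg_comp; apply/eqP; congr (_ @: _)%VS.
apply/lfunP=> f; rewrite comp_lfunE !lfunE; apply/ffunP=> x.
by rewrite !ffunE permM.
Qed.

Canonical code_aut_group C := Group (code_aut_group_set C).

Definition symmetric_code C : bool :=
  [transitive code_aut C, on [set: X] | 'P].

End CodeInvariants.

End Codes.

Section CayleyCode.
Variables (gT : finGroupType) (G S : {set gT}).

Definition cayley_edges : {set {set gT}} :=
  [set [set g; (s * g)%g] | g in G, s in S].

Fact cayley_edge_subproof (g : elt G) (s : elt S) :
  [set val g; (val s * val g)%g] \in cayley_edges.
Proof. by apply/imset2P; exists (val g) (val s) => //; apply: valP. Qed.

Definition cayley_edge (g : elt G) (s : elt S) : elt cayley_edges :=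
  exist _ [set val g; (val s * val g)%g] (cayley_edge_subproof g s).

Variables (F : fieldType) (B : code F (elt S)).

Definition cayley_code : code F (elt cayley_edges) :=
  (\bigcap_(g : elt G) linfun (pullback (cayley_edge g)) @^-1: B)%VS.

Lemma cayley_codeP (f : {ffun elt cayley_edges -> F^o}) :
  reflect (forall g : elt G, [ffun s => f (cayley_edge g s)] \in B)
          (f \in cayley_code).
Proof.
rewrite memvE; apply: (iffP subv_bigcapP) => Bf g.
  by have := Bf g isT; rewrite -memvE -memv_preim lfunE.
by rewrite -memvE -memv_preim lfunE => _; apply: Bf.
Qed.

End CayleyCode.

(* Main.v *)
(** Right translation by representatives of the right cosets of [H] in [G]
    embeds [Cay(H, S)] into [Cay(G, S)] as [#|G : H|] disjoint copies covering
    all edges, and the constraint at a vertex only involves the copy containing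
    it. So [C(G, S, B)] is a power of [C(H, S, B)], and everything holds for
    powers of an arbitrary code [D]. The only delicate point is that [D] is
    symmetric when its power [C] is, since an automorphism of [C] need not
    permute the copies of [D]. It does permute the indecomposable components
    of [C], each of which lies inside one copy. If it maps [x] to [y], in the
    same copy, then exchanging the components of [x] and [y] along it, and
    fixing all other coordinates, is an automorphism of [C] that preserves
    this copy. *)

Require Import Defs.
From HB Require Import structures.
From mathcomp Require Import all_boot all_order all_algebra all_fingroup.

Import GroupScope GRing.Theory.
Local Open Scope ring_scope.

Set Implicit Arguments.
Unset Strict Implicit.
Unset Printing Implicit Defensive.

(** * Code automorphisms tested on words, symmetry tested on points *)

Section Automorphisms.
Variables (F : fieldType) (X : finType).
Implicit Types (C : code F X) (f : {ffun X -> F^o}) (rho : {perm X}).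

(** Pullback along a permutation is injective, so by dimension the image of [C] equals [C] as soon
    as it lies in [C]. *)
Lemma code_autP C rho :
  reflect (forall f, f \in C -> pullback rho f \in C) (rho \in code_aut C).
Proof.
rewrite inE; apply: (iffP eqP) => [Crho f Cf | stabC].
  by rewrite -Crho; apply/memv_imgP; exists f; rewrite ?lfunE.
apply/eqP; rewrite eqEdim; apply/andP; split.
  by apply/subvP=> _ /memv_imgP[f Cf ->]; rewrite lfunE stabC.
rewrite limg_dim_eq //; apply/eqP; rewrite -subv0.
apply/subvP=> f; rewrite memv_cap memv_ker lfunE memv0 => /andP[_ /eqP f0].
apply/eqP/ffunP=> x; move/ffunP/(_ (rho^-1%g x)): f0.
by rewrite !ffunE permKV.
Qed.

(** Transitivity on [[set: X]] asks that this set be an orbit, hence non-empty: this is the first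
    conjunct. *)
Lemma symmetric_codeP C :
  reflect ((exists x : X, True) /\
           forall x y, exists2 rho, rho \in code_aut C & rho x = y)
          (symmetric_code C).
Proof.
apply: (iffP idP) => [trC | [[x _] trC]].
  split=> [|x y]; first by case/imsetP: trC => x _ _; exists x.
  by have [rho Crho ->] := atransP2 trC (in_setT x) (in_setT y); exists rho.
apply/imsetP; exists x => //; apply/setP=> y; rewrite inE; apply/esym.
by have [rho Crho <-] := trC x y; apply/orbitP; exists rho.
Qed.

End Automorphisms.

(** * Separators and indecomposable components of a code *)

Section Components.
Variables (F : fieldType) (X : finType).
Implicit Types (A K : {set X}) (C : code F X) (f : {ffun X -> F^o}).

Definition restrict A f : {ffun X -> F^o} := [ffun x => if x \in A then f x else 0].

Fact restrict_is_linear A : linear (restrict A).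
Proof.
move=> a f g; apply/ffunP=> x; rewrite !ffunE.
by case: ifP => _; rewrite ?ffunE // scaler0 addr0.
Qed.

HB.instance Definition _ A :=
  GRing.isLinear.Build F {ffun X -> F^o} {ffun X -> F^o} *:%R (restrict A)
    (restrict_is_linear A).

(** Equivalently, [C] is the direct sum of its subcodes supported in [A] and in [~: A]. *)
Definition separator C A := (linfun (restrict A) @: C <= C)%VS.

Lemma separatorP C A :
  reflect (forall f, f \in C -> restrict A f \in C) (separator C A).
Proof.
apply: (iffP subvP) => [sepA f Cf | sepA _ /memv_imgP[f Cf ->]].
  by apply: sepA; apply/memv_imgP; exists f; rewrite ?lfunE.
by rewrite lfunE sepA.
Qed.

Lemma separatorT C : separator C setT.
Proof.
apply/separatorP=> f Cf; suff ->: restrict setT f = f by [].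
by apply/ffunP=> x; rewrite ffunE in_setT.
Qed.

Lemma separatorI C A K : separator C A -> separator C K -> separator C (A :&: K).
Proof.
move=> /separatorP sepA /separatorP sepK; apply/separatorP=> f Cf.
suff ->: restrict (A :&: K) f = restrict A (restrict K f) by rewrite sepA ?sepK.
by apply/ffunP=> x; rewrite !ffunE inE; case: (x \in A).
Qed.

Lemma separatorC C A : separator C A -> separator C (~: A).
Proof.
move=> /separatorP sepA; apply/separatorP=> f Cf.
suff ->: restrict (~: A) f = f - restrict A f by rewrite rpredB ?sepA.
by apply/ffunP=> x; rewrite !ffunE inE; case: (x \in A); rewrite ?subrr ?subr0.
Qed.

(** Restriction to the preimage is restriction to [A] conjugated by the pullback along [rho]. *)
Lemma separator_preim C A (rho : {perm X}) :
  rho \in code_aut C -> separator C A -> separator C (rho @^-1: A).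
Proof.
move=> Crho /separatorP sepA; apply/separatorP=> f Cf.
have ->: restrict (rho @^-1: A) f
         = pullback rho (restrict A (pullback rho^-1%g f)).
  by apply/ffunP=> x; rewrite !ffunE inE permK.
by apply: (code_autP _ _ Crho); apply/sepA/code_autP; rewrite ?groupV.
Qed.

(** The least separator containing [x], an atom of the Boolean algebra of separators. *)
Definition component C x := \bigcap_(A | separator C A && (x \in A)) A.

Lemma mem_component C x : x \in component C x.
Proof. by apply/bigcapP=> A /andP[]. Qed.

Lemma component_sub C A x : separator C A -> x \in A -> component C x \subset A.
Proof. by move=> sepA Ax; apply: bigcap_inf; rewrite sepA. Qed.

Lemma separator_component C x : separator C (component C x).
Proof.
apply: (big_ind (separator C)) => [|A K|A /andP[] //]; first exact: separatorT.
exact: separatorI.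
Qed.

(** By minimality: if [x] were outside [component C y], removing that set from [component C x] would
    leave a separator that contains [x] but not [y]. *)
Lemma component_eq C x y : y \in component C x -> component C y = component C x.
Proof.
move=> Kxy; have sepK := separator_component C.
apply/eqP; rewrite eqEsubset component_sub //=; apply: component_sub => //.
apply: contraLR Kxy => Kyx.
have sepD := separatorI (sepK x) (separatorC (sepK y)).
have /subsetP/(_ y) : component C x \subset component C x :&: ~: component C y.
  by apply: component_sub => //; rewrite !inE mem_component.
by rewrite !inE mem_component andbF => notKxy; apply/negP=> /notKxy.
Qed.

(** Preimages of separators under [rho] are separators, so least ones correspond; the inverse of
    [rho] gives the converse. *)
Lemma component_aut C (rho : {perm X}) x z :
  rho \in code_aut C -> (rho z \in component C (rho x)) = (z \in component C x).
Proof.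
have half r u v : r \in code_aut C -> u \in component C v ->
    r u \in component C (r v).
  move=> Cr; apply: contraLR => Kru.
  have sepr := separator_preim Cr (separator_component C (r v)).
  apply/negP=> /(subsetP (component_sub sepr _)); rewrite !inE mem_component.
  by move=> /(_ isT); apply/negP.
move=> Crho; apply/idP/idP; last exact: half.
by move/(half rho^-1%g); rewrite groupV !permK; apply.
Qed.

Lemma component_swap C (rho : {perm X}) x : rho \in code_aut C ->
  exists sigma, [/\ sigma \in code_aut C, sigma x = rho x
    & forall A, separator C A -> x \in A -> rho x \in A ->
      forall z, z \in A -> sigma z \in A].
Proof.
move=> Crho; set K := component C x; set L := component C (rho x).
have KL z : z \in K -> rho z \in L by rewrite component_aut.
have LK z : z \in L -> rho^-1%g z \in K.
  by move=> Lz; rewrite -(component_aut _ _ Crho) permKV.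
have eqKL z : z \in K -> z \in L -> K = L.
  by move=> Kz Lz; rewrite /K -(component_eq Kz) (component_eq Lz).
(* If [K] and [L] meet they are equal, and [swap] is then [rho] on [K]; otherwise it exchanges
   them. *)
pose swap z := if z \in K then rho z else if z \in L then rho^-1%g z else z.
have swap_inj : injective swap.
  have swapK z : z \in K -> (swap z = rho z) /\ (swap z \in L).
    by rewrite /swap => Kz; rewrite Kz KL.
  have swapL z : z \notin K -> z \in L -> (swap z = rho^-1%g z) /\ (swap z \in K).
    by rewrite /swap => /negbTE -> Lz; rewrite Lz LK.
  have swap0 z : z \notin K -> z \notin L -> swap z = z.
    by rewrite /swap => /negbTE -> /negbTE ->.
  move=> u v.
  have [Ku|nKu] := boolP (u \in K); have [Kv|nKv] := boolP (v \in K).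
  - by rewrite !(swapK _ _).1 //; apply: perm_inj.
  - have [Lv|nLv] := boolP (v \in L).
      (* The common image lies in both [L] and [K], which forces [K = L] and contradicts the choice
         of [v]. *)
      move=> E; have [_ Lu] := swapK u Ku; have [_ Kw] := swapL v nKv Lv.
      by rewrite E in Lu; move: nKv; rewrite (eqKL _ Kw Lu) Lv.
    by rewrite (swap0 v) // => E; have [_] := swapK u Ku; rewrite E (negbTE nLv).
  - have [Lu|nLu] := boolP (u \in L).
      move=> E; have [_ Lv] := swapK v Kv; have [_ Kw] := swapL u nKu Lu.
      by rewrite -E in Lv; move: nKu; rewrite (eqKL _ Kw Lv) Lu.
    by rewrite (swap0 u) // => E; have [_] := swapK v Kv; rewrite -E (negbTE nLu).
  have [Lu|nLu] := boolP (u \in L); have [Lv|nLv] := boolP (v \in L).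
  - by rewrite (swapL u _ _).1 // (swapL v _ _).1 //; apply: perm_inj.
  - rewrite (swap0 v) // => E; have [_] := swapL u nKu Lu.
    by rewrite E (negbTE nKv).
  - rewrite (swap0 u) // => E; have [_] := swapL v nKv Lv.
    by rewrite -E (negbTE nKu).
  by rewrite !swap0.
exists (perm swap_inj); split=> [||A sepA Ax Arx z Az].
- apply/code_autP=> f Cf.
  have sepK : separator C K := separator_component C x.
  have sepL : separator C L := separator_component C (rho x).
  (* The three pieces restrict words of [C], the pullbacks of [f] along [rho], its inverse and the
     identity, to disjoint separators. *)
  have ->: pullback (perm swap_inj) f = restrict K (pullback rho f)
    + restrict (~: K :&: L) (pullback rho^-1%g f) + restrict (~: K :&: ~: L) f.
    apply/ffunP=> z; rewrite !ffunE permE /swap !inE.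
    by case: (z \in K); case: (z \in L); rewrite ?addr0 ?add0r.
  have rV : rho^-1%g \in code_aut C by rewrite groupV.
  have sepKc := separatorC sepK.
  apply: rpredD; first apply: rpredD.
  + by apply: (separatorP _ _ sepK); apply: (code_autP _ _ Crho).
  + apply: (separatorP _ _ (separatorI sepKc sepL)).
    exact: (code_autP _ _ rV).
  + exact: (separatorP _ _ (separatorI sepKc (separatorC sepL))).
- by rewrite permE /swap mem_component.
(* As a separator containing [x] and [rho x], [A] contains both [K] and [L]. *)
rewrite permE /swap; case: ifP => [/KL|_].
  exact/subsetP/component_sub.
by case: ifP => [/LK|//]; apply/subsetP/component_sub.
Qed.

End Components.

(* [C] is the [I]-th power of [D]: its coordinates form the copies [h i] of
   those of [D], and its words restrict to arbitrary words of [D] on each. *)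
Section Power.
Variables (F : fieldType) (I X Y : finType).
Variables (h : I -> Y -> X) (copy : X -> I) (coord : X -> Y).
Hypotheses (copyK : forall i y, copy (h i y) = i)
  (coordK : forall i y, coord (h i y) = y)
  (hK : forall x, h (copy x) (coord x) = x).
Variables (C : code F X) (D : code F Y).
Hypothesis memC : forall f, f \in C <-> forall i, pullback (h i) f \in D.
Implicit Types (f : {ffun X -> F^o}) (d : {ffun Y -> F^o}).

Definition copy_set i : {set X} := [set x | copy x == i].

Definition copy_coord i (x : elt (copy_set i)) : Y := coord (val x).

(** Factoring through [ext0] gives the image of [D] the form of a summand in [code_direct_sum]. *)
Definition copy_ext i : 'Hom({ffun Y -> F^o}, {ffun X -> F^o}) :=
  (linfun (@ext0 F X (copy_set i)) \o linfun (pullback (@copy_coord i)))%VF.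

Lemma copy_coord_bij i : bijective (@copy_coord i).
Proof.
have hP y : h i y \in copy_set i by rewrite inE copyK.
exists (fun y => exist _ (h i y) (hP y)) => [[x xi] | y]; last exact: coordK.
apply: val_inj; rewrite /copy_coord /=.
by have := xi; rewrite inE => /eqP <-; apply: hK.
Qed.

Lemma copy_extE i d x : copy_ext i d x = if copy x == i then d (coord x) else 0.
Proof.
rewrite comp_lfunE !lfunE ffunE.
case: insubP => [u xi ux | /negbTE]; last by rewrite inE => ->.
by move: xi; rewrite inE => -> /=; rewrite ffunE /copy_coord ux.
Qed.

(** The maps [copy_ext i] are the inclusions of a direct sum whose projections are the pullbacks
    along [h j]. *)
Lemma pullback_copy_ext i j d :
  pullback (h j) (copy_ext i d) = if j == i then d else 0.
Proof.
apply/ffunP=> y; rewrite ffunE copy_extE copyK coordK.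
by case: ifP; rewrite ?ffunE.
Qed.

Lemma copy_ext_mem i d : d \in D -> copy_ext i d \in C.
Proof.
move=> Dd; apply/memC=> j; rewrite pullback_copy_ext.
by case: ifP => _; rewrite ?rpred0.
Qed.

Lemma sum_copy_ext f : f = \sum_i copy_ext i (pullback (h i) f).
Proof.
apply/ffunP=> x; rewrite sum_ffunE (bigD1 (copy x)) //= copy_extE eqxx ffunE hK.
rewrite big1 ?addr0 // => i /negbTE nxi.
by rewrite copy_extE eq_sym nxi.
Qed.

Lemma power_directv : directv (\sum_i (copy_ext i @: D)).
Proof.
apply/directv_sum_independent => u Du sum0 i _.
have {}Du j : exists2 d, d \in D & u j = copy_ext j d by apply/memv_imgP/Du.
have [d _ uid] := Du i; rewrite uid.
suff ->: d = 0 by rewrite linear0.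
(* Projecting to copy [i] kills every term but the [i]-th. *)
move/(congr1 (pullback (h i))): sum0; rewrite linear0 linear_sum (bigD1 i) //=.
rewrite uid pullback_copy_ext eqxx big1 ?addr0 // => j /negbTE nji.
by have [e _ ->] := Du j; rewrite pullback_copy_ext eq_sym nji.
Qed.

Lemma power_sum : C = (\sum_i (copy_ext i @: D))%VS.
Proof.
apply: subv_anti; apply/andP; split.
  apply/subvP=> f /memC Cf; rewrite [f]sum_copy_ext.
  by apply: memv_sumr => i _; apply: memv_img.
apply/subv_sumP=> i _; apply/subvP=> _ /memv_imgP[d Dd ->].
exact: copy_ext_mem.
Qed.

Lemma power_direct_sum :
  code_direct_sum (fun i => linfun (pullback (@copy_coord i)) @: D)%VS C.
Proof.
have ext_comp i : (linfun (@ext0 F X (copy_set i))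
    @: (linfun (pullback (@copy_coord i)) @: D) = copy_ext i @: D)%VS.
  by rewrite limg_comp.
split=> [i j nij | | |].
- rewrite -setI_eq0; apply/eqP/setP=> x; rewrite !inE.
  by case: eqP => // ->; apply/negbTE.
- by apply/setP=> x; rewrite inE; apply/bigcupP; exists (copy x); rewrite ?inE.
- have /directv_sum_independent indep := power_directv.
  apply/directv_sum_independent=> u Du; apply: indep => i _.
  by rewrite -ext_comp Du.
by rewrite power_sum; apply: eq_bigr => i _; rewrite ext_comp.
Qed.

Lemma dim_power : \dim C = (#|I| * \dim D)%N.
Proof.
rewrite power_sum (directvP power_directv) /= -sum_nat_const.
apply: eq_bigr => i _; apply: limg_dim_eq; apply/eqP; rewrite -subv0.
apply/subvP=> d; rewrite memv_cap memv_ker memv0 => /andP[_ /eqP d0].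
(* Writing [d] as a conditional lets [pullback_copy_ext] apply backwards: [copy_ext i] has a left
   inverse, so its kernel is zero. *)
by rewrite -[d]/(if true then d else 0) -(eqxx i) -pullback_copy_ext d0 linear0.
Qed.

Lemma card_power : #|X| = (#|I| * #|Y|)%N.
Proof.
rewrite -card_prod; apply: (@bij_eq_card _ _ (fun x => (copy x, coord x))).
exists (fun p => h p.1 p.2) => [x | [i y]] /=; first exact: hK.
by rewrite copyK coordK.
Qed.

Lemma hamming_weight_copy_ext i d :
  hamming_weight (copy_ext i d) = hamming_weight d.
Proof.
rewrite /hamming_weight -(card_imset _ (can_inj (coordK i))).
apply: eq_card => x; rewrite inE copy_extE.
apply/idP/imsetP=> [|[y]]; last by rewrite inE => dy ->; rewrite copyK coordK eqxx.
case: (copy x =P i) => [<- dx|_]; last by rewrite eqxx.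
by exists (coord x); rewrite ?inE ?hK.
Qed.

Lemma hamming_weight_pullback_copy i f :
  (hamming_weight (pullback (h i) f) <= hamming_weight f)%N.
Proof.
rewrite /hamming_weight -(card_imset _ (can_inj (coordK i))).
by apply/subset_leq_card/subsetP=> _ /imsetP[y + ->]; rewrite !inE ffunE.
Qed.

(** * Rate, minimum distance and symmetry of a power with at least one copy *)

Variable i0 : I.

Lemma rate_power : rate D = rate C.
Proof.
have I_neq0 : #|I|%:R != 0 :> rat.
  by rewrite Num.Theory.pnatr_eq0 -lt0n; apply/card_gt0P; exists i0.
by rewrite /rate dim_power card_power !natrM -mulf_div divff ?mul1r.
Qed.

(** Extension by zero keeps the weight, restriction to a copy does not raise it, and a non-zero word
    is non-zero on some copy. *)
Lemma min_distance_power n : is_min_distance D n <-> is_min_distance C n.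
Proof.
have ext_neq0 u : u != 0 -> copy_ext i0 u != 0.
  apply: contraNneq => /(congr1 (pullback (h i0))).
  by rewrite pullback_copy_ext eqxx linear0 => ->.
have pullback_neq0 f : f != 0 -> exists i, pullback (h i) f != 0.
  move=> nf; apply/existsP; apply: contraNT nf; rewrite negb_exists => /forallP f0.
  rewrite [f]sum_copy_ext big1 // => i _.
  by move/negPn/eqP: (f0 i) => ->; rewrite linear0.
split=> -[[f [Df nf wf]] min_d]; split.
- exists (copy_ext i0 f).
  by rewrite copy_ext_mem ?ext_neq0 ?hamming_weight_copy_ext.
- move=> g /memC Cg /pullback_neq0[i ng].
  by apply: leq_trans (min_d _ (Cg i) ng) (hamming_weight_pullback_copy _ _).
- have [i nfi] := pullback_neq0 f nf; exists (pullback (h i) f).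
  have /memC Cf := Df; split=> //; apply/eqP; rewrite eqn_leq -{1}wf.
  rewrite hamming_weight_pullback_copy -(hamming_weight_copy_ext i0).
  by rewrite min_d ?ext_neq0 ?copy_ext_mem.
move=> u Du nu; rewrite -(hamming_weight_copy_ext i0).
by rewrite min_d ?ext_neq0 ?copy_ext_mem.
Qed.

Lemma separator_copy i : separator C (copy_set i).
Proof.
apply/separatorP=> f /memC Cf.
suff ->: restrict (copy_set i) f = copy_ext i (pullback (h i) f).
  exact: copy_ext_mem.
apply/ffunP=> x; rewrite ffunE copy_extE inE ffunE.
by case: eqP => // <-; rewrite hK.
Qed.

Lemma symmetric_code_power : symmetric_code D <-> symmetric_code C.
Proof.
split=> /symmetric_codeP[[x _] trans]; apply/symmetric_codeP.
  split=> [|x1 x2]; first by exists (h i0 x).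
  have [sigma Dsigma sigma_x1] := trans (coord x1) (coord x2).
  (* The required automorphism permutes the copies by [pi] and acts as [sigma] on the coordinates
     within each. *)
  pose pi := tperm (copy x1) (copy x2).
  have rho_inj : injective (fun z => h (pi (copy z)) (sigma (coord z))).
    move=> u v E; move/(congr1 copy): (E); move/(congr1 coord): E.
    rewrite !copyK !coordK => /perm_inj Euv /perm_inj Eiuv.
    by rewrite -(hK u) Euv Eiuv hK.
  exists (perm rho_inj); last by rewrite permE tpermL sigma_x1 hK.
  apply/code_autP=> f /memC Cf; apply/memC=> i.
  suff ->: pullback (h i) (pullback (perm rho_inj) f)
           = pullback sigma (pullback (h (pi i)) f).
    exact: (code_autP _ _ Dsigma).
  by apply/ffunP=> y; rewrite !ffunE permE copyK coordK.
split=> [|y1 y2]; first by exists (coord x).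
have [rho Crho rho_y1] := trans (h i0 y1) (h i0 y2).
(* [rho] may scatter copy [i0]. That copy is a separator containing both points, so [sigma]
   preserves it. *)
have [sigma [Csigma sigma_y1 sigmaA]] := component_swap (h i0 y1) Crho.
have copy_sigma y : copy (sigma (h i0 y)) = i0.
  apply/eqP; have := sigmaA _ (separator_copy i0); rewrite rho_y1 !inE !copyK.
  by move=> /(_ (eqxx _) (eqxx _) (h i0 y)); rewrite !inE copyK => ->.
have h_sigma y : h i0 (coord (sigma (h i0 y))) = sigma (h i0 y).
  by rewrite -{1}(copy_sigma y) hK.
have tau_inj : injective (fun y => coord (sigma (h i0 y))).
  move=> u v /(congr1 (h i0)); rewrite !h_sigma => /perm_inj.
  exact: can_inj (coordK i0) _ _.
exists (perm tau_inj); last by rewrite permE sigma_y1 rho_y1 coordK.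
apply/code_autP=> d Dd.
(* Extend [d] by zero to a word of [C], apply [sigma], and restrict back to copy [i0]. *)
have /memC/(_ i0) := code_autP _ _ Csigma _ (copy_ext_mem i0 Dd).
congr (_ \in D); apply/ffunP=> y.
by rewrite !ffunE permE copy_extE copy_sigma eqxx.
Qed.

End Power.

(** * The copies of the Cayley graph of [H] inside that of [G] *)

Section CayleyPower.
Variables (gT : finGroupType) (G H : {group gT}) (S : {set gT}).
Hypotheses (sSH : S \subset H) (sHG : H \subset G).

(** [#|G : H|] is by definition the cardinal of [rcosets H G], so [enum_val i] is a right coset. *)
Definition coset_rep (i : 'I_#|G : H|) : gT := repr (enum_val i).

Lemma coset_repP i : coset_rep i \in G /\ enum_val i = H :* coset_rep i.
Proof.
have /rcosetsP[g Gg def_i] := enum_valP i; rewrite /coset_rep def_i.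
split; last by rewrite rcoset_repr.
have : repr (H :* g) \in H :* g := mem_repr_rcoset _ _.
by case/rcosetP=> a Ha ->; rewrite groupM // (subsetP sHG).
Qed.

Lemma coset_rep_decomp g :
  g \in G -> exists i, exists2 a, a \in H & g = (a * coset_rep i)%g.
Proof.
move=> Gg; have HgG : H :* g \in rcosets H G by apply/rcosetsP; exists g.
exists (enum_rank_in HgG (H :* g)); apply/rcosetP.
have [_ <-] := coset_repP (enum_rank_in HgG (H :* g)).
by rewrite enum_rankK_in // rcoset_refl.
Qed.

(** Edges come from left multiplication by [S], which commutes with right translation. *)
Lemma translate_edge (g s x : gT) :
  [set g; (s * g)%g] :* x = [set (g * x)%g; (s * (g * x))%g].
Proof. by rewrite -rcosetE /rcoset imsetU !imset_set1 mulgA. Qed.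

Fact copy_edge_subproof i (e : elt (cayley_edges H S)) :
  val e :* coset_rep i \in cayley_edges G S.
Proof.
have /imset2P[a s Ha Ss ->] := valP e; rewrite translate_edge.
have [Gr _] := coset_repP i; apply/imset2P; exists (a * coset_rep i)%g s => //.
by rewrite groupM // (subsetP sHG).
Qed.

Definition copy_edge i (e : elt (cayley_edges H S)) : elt (cayley_edges G S) :=
  exist _ (val e :* coset_rep i) (copy_edge_subproof i e).

Lemma copy_edgeE i a s (Ha : a \in H) (Ga : (a * coset_rep i)%g \in G) :
  copy_edge i (cayley_edge (exist _ a Ha) s)
  = cayley_edge (exist _ (a * coset_rep i)%g Ga) s.
Proof. by apply: val_inj; rewrite /= translate_edge. Qed.

(** Since [S] lies in [H], both ends of an edge of copy [i] lie in the [i]-th coset, so the edge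
    determines [i]; right translation is injective. *)
Lemma copy_edge_inj i j e e' : copy_edge i e = copy_edge j e' -> i = j /\ e = e'.
Proof.
move/(congr1 val) => /= Eij.
have eqij : i = j.
  have /imset2P[a s Ha Ss def_e] := valP e.
  have /imset2P[b t Hb St def_e'] := valP e'.
  apply: enum_val_inj; have [_ ->] := coset_repP i; have [_ ->] := coset_repP j.
  have cosetS c u r : c \in H -> u \in S ->
      [set (c * r)%g; (u * (c * r))%g] \subset H :* r.
    move=> Hc /(subsetP sSH) Hu; apply/subsetP=> z /set2P[] ->.
      by rewrite mem_rcoset mulgK.
    by rewrite mem_rcoset mulgA mulgK groupM.
  move: Eij; rewrite def_e def_e' !translate_edge => Eij.
  have inHj : (a * coset_rep i)%g \in H :* coset_rep j.
    by apply: (subsetP (cosetS b t _ Hb St)); rewrite -Eij !inE eqxx.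
  have inHi : (a * coset_rep i)%g \in H :* coset_rep i.
    by rewrite mem_rcoset mulgK.
  by rewrite -(rcoset_eqP inHi) -(rcoset_eqP inHj).
split=> //; apply: val_inj.
by move: Eij; rewrite -eqij => /(@rcoset_inj _ (coset_rep i)).
Qed.

Lemma copy_edge_surj x : exists p, copy_edge p.1 p.2 = x.
Proof.
have /imset2P[g s Gg Ss def_x] := valP x.
have [i [a Ha def_g]] := coset_rep_decomp Gg; rewrite def_g in Gg def_x.
exists (i, cayley_edge (exist _ a Ha) (exist _ s Ss)).
by apply: val_inj; rewrite def_x /= translate_edge.
Qed.

Variables (F : fieldType) (B : code F (elt S)).

(** The constraint at the vertex [a * coset_rep i] is the one at [a] for the pullback of [f] to copy
    [i]. *)
Lemma cayley_code_copies f :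
  f \in cayley_code G B
  <-> forall i, pullback (copy_edge i) f \in cayley_code H B.
Proof.
split=> [/cayley_codeP Cf i | Cf].
  apply/cayley_codeP=> -[a Ha].
  have Ga : (a * coset_rep i)%g \in G.
    by have [Gr _] := coset_repP i; rewrite groupM // (subsetP sHG).
  have := Cf (exist _ (a * coset_rep i)%g Ga); congr (_ \in B).
  by apply/ffunP=> s; rewrite !ffunE copy_edgeE.
apply/cayley_codeP=> -[g Gg].
have [i [a Ha def_g]] := coset_rep_decomp Gg; subst g.
have /cayley_codeP/(_ (exist _ a Ha)) := Cf i; congr (_ \in B).
by apply/ffunP=> s; rewrite !ffunE copy_edgeE.
Qed.

End CayleyPower.

Theorem theorem1p2 (gT : finGroupType) (G : {group gT}) (S : {set gT})
    (S_neq0 : S != set0) (S_sub : S \subset G^#%g)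
    (S_inv : forall s, s \in S -> s^-1%g \in S)
    (S_gen : <<S>>%g != G)
    (F : finFieldType) (B : code F (elt S)) :
  (exists (A : 'I_#|G : <<S>>|%g -> {set elt (cayley_edges G S)})
          (D : forall i, code F (elt (A i))),
      code_direct_sum D (cayley_code G B) /\
      forall i, code_iso (D i) (cayley_code <<S>>%g B))
  /\
  [/\ rate (cayley_code <<S>>%g B) = rate (cayley_code G B),
      forall d, is_min_distance (cayley_code <<S>>%g B) d <->
                is_min_distance (cayley_code G B) d
    & symmetric_code (cayley_code <<S>>%g B) <->
      symmetric_code (cayley_code G B)].
Proof.
have sSH : S \subset <<S>>%G by apply: subset_gen.
have sHG : <<S>>%G \subset G.
  by rewrite gen_subG; apply: subset_trans S_sub (subsetDl _ _).
(* Surjectivity provides a section of the map from pairs to edges; injectivity makes it a two-sided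
   inverse. *)
have [copy [coord [copyK coordK hK]]] : exists copy coord,
    [/\ forall i e, copy (copy_edge sHG (S := S) i e) = i,
        forall i e, coord (copy_edge sHG (S := S) i e) = e
      & forall x, copy_edge sHG (copy x) (coord x) = x].
  have [p pK] := fin_all_exists (copy_edge_surj sHG (S := S)).
  exists (fun x => (p x).1), (fun x => (p x).2).
  by split=> // i e; have [] := copy_edge_inj sSH (pK (copy_edge sHG i e)).
have i0 : 'I_#|G : <<S>>%G| by exists 0%N; apply: indexg_gt0.
have memC := cayley_code_copies sHG B.
split.
  (* Each summand is the code of [<<S>>] transported along [copy_coord], which is then itself the
     isomorphism. *)
  exists (copy_set copy), (fun i =>
    linfun (pullback (@copy_coord _ _ _ copy coord i)) @: cayley_code <<S>>%G B)%VS.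
  split; first exact: (power_direct_sum copyK coordK hK memC).
  move=> i; exists (@copy_coord _ _ _ copy coord i) => //.
  exact: (copy_coord_bij copyK coordK hK).
split=> [|d|].
- exact: (rate_power copyK coordK hK memC i0).
- exact: (min_distance_power copyK coordK hK memC i0).
exact: (symmetric_code_power copyK coordK hK memC i0).
Qed.
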